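(* Let $\Delta\subseteq\mathbb{C}$ with $\Delta\cap\mathbb{R}\neq\emptyset$. Consider a network of one-dimensional subsystems (N1DS), i.e. $l_1=\cdots=l_n=1$ (so $\mathcal{L}=(1,\ldots,1)$), with pattern matrix $\mathcal{A}\in\{0,*,?\}^{n\times n}$, $\Delta$-characteristic vector $f^{\mathcal{L}}_{\Delta}$, dynamics $\dot x=Ax+Bu$ with $A\in\mathcal{S}(f^{\mathcal{L}}_{\Delta},\mathcal{A})$, set of control subsystems $V_C\subseteq\{1,\ldots,n\}$ (which determines $B$), and $\Delta$-network graph $G_{\mathcal{N}}^{\Delta}=(V_{\mathcal{N}},E_{\mathcal{N}})$. Then the network is $\Delta$-SSC if and only if $V_C$ is a zero forcing set of $G_{\mathcal{N}}^{\Delta}$.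
   Context: Pattern matrices. A pattern matrix has entries in the set of symbols $\{0,*,?\}$. For an $n\times n$ pattern matrix $\mathcal{A}$, its pattern class $\mathcal{P}(\mathcal{A})$ is the set of all $A\in\mathbb{R}^{n\times n}$ with $A(i,j)=0$ whenever $\mathcal{A}(i,j)=0$ and $A(i,j)\neq 0$ whenever $\mathcal{A}(i,j)=*$ (entries with symbol $?$ are arbitrary reals). Network. In an N1DS every subsystem $i\in\{1,\ldots,n\}$ has a scalar state, with $1\times 1$ system matrix $A_{ii}=A(i,i)$, so $\Lambda(A_{ii})=\{A(i,i)\}$, where $\Lambda(\cdot)$ denotes the spectrum. Given a set $V_C\subseteq\{1,\ldots,n\}$ of control subsystems, $B$ is the matrix whose columns are the standard basis vectors $e_k\in\mathbb{R}^n$, $k\in V_C$. $\Delta$-characteristic vector and $\Delta$-specified pattern class. A $\Delta$-characteristic vector is a vector $f^{\mathcal{L}}_{\Delta}\in\{0,*,?\}^n$, with $f^{\mathcal{L}}_{\Delta}\in\{*,?\}^n$ if $|\Delta|>1$; it encodes available information on $\Lambda(A_{kk})\cap\Delta$. It is either given directly, or obtained from a given set $\mathcal{S}^*$ of system matrices by: $f^{\mathcal{L}}_{\Delta}(k)=*$ if $\Lambda(A_{kk})\cap\Delta=\emptyset$ for all $A\in\mathcal{S}^*$; $f^{\mathcal{L}}_{\Delta}(k)=0$ if $\Delta=\{\mu\}$ and $A_{kk}=\mu$ for all $A\in\mathcal{S}^*$; $f^{\mathcal{L}}_{\Delta}(k)=?$ otherwise. The $\Delta$-specified pattern class $\mathcal{S}(f^{\mathcal{L}}_{\Delta},\mathcal{A})$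 is the set of all $A\in\mathcal{P}(\mathcal{A})$ such that, for each $k$, $\Lambda(A_{kk})\cap\Delta=\emptyset$ (i.e. $A(k,k)\notin\Delta$) if $f^{\mathcal{L}}_{\Delta}(k)=*$, and $A(k,k)=\mu$ if $\Delta=\{\mu\}$ and $f^{\mathcal{L}}_{\Delta}(k)=0$. $\Delta$-SSC. An eigenvalue $\lambda$ of $A$ is controllable for $(A,B)$ if it is not an eigenvalue of the uncontrollable block in the Kalman controllability decomposition of $(A,B)$; equivalently (PBH test), every nonzero $w\in\mathbb{C}^n$ with $w^TA=\lambda w^T$ satisfies $w^TB\neq 0$. The network is $\Delta$-SSC (modal strongly structurally controllable with respect to $\Delta$) if for every $\lambda\in\Delta$ and every $A\in\mathcal{S}(f^{\mathcal{L}}_{\Delta},\mathcal{A})$ with $\lambda\in\Lambda(A)$, $\lambda$ is a controllable eigenvalue of $(A,B)$. $\Delta$-network graph (one-dimensional subsystems). $G_{\mathcal{N}}^{\Delta}=(V_{\mathcal{N}},E_{\mathcal{N}})$ is the directed graph (self-loops allowed) with $V_{\mathcal{N}}=\{1,\ldots,n\}$ and $E_{\mathcal{N}}=E^*_{\mathcal{N}}\cup E^?_{\mathcal{N}}$ (disjoint), where: the self-loop $(i,i)$ is absent if $f^{\mathcal{L}}_{\Delta}(i)=0$, lies in $E^*_{\mathcal{N}}$ if $f^{\mathcal{L}}_{\Delta}(i)=*$, and lies in $E^?_{\mathcal{N}}$ if $f^{\mathcal{L}}_{\Delta}(i)=?$; for $i\neq j$, $(j,i)\notin E_{\mathcal{N}}$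 if $\mathcal{A}(i,j)=0$, $(j,i)\in E^*_{\mathcal{N}}$ if $\mathcal{A}(i,j)=*$, and $(j,i)\in E^?_{\mathcal{N}}$ if $\mathcal{A}(i,j)=?$. If $(v,u)\in E_{\mathcal{N}}$, $u$ is an out-neighbor of $v$; it is strong if $(v,u)\in E^*_{\mathcal{N}}$ and weak if $(v,u)\in E^?_{\mathcal{N}}$ (a node with a self-loop is an out-neighbor of itself). Coloring and zero forcing sets. Start with the nodes of a set $Z$ black and all others white. Coloring rule: a white node $u$ is colored black if there is a node $v$ (black or white, possibly $v=u$) such that $u$ is the only white out-neighbor of $v$ and $(v,u)\in E^*_{\mathcal{N}}$. Apply the rule repeatedly until no further change is possible; the final set of black nodes is the derived set $\mathcal{D}(Z)$. $Z$ is a zero forcing set (ZFS) if $\mathcal{D}(Z)=V_{\mathcal{N}}$.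
   Formalization: ZFS ⇒ Δ-SSC is proved as stated; the converse, false in general, is proved assuming S(f,A) is nonempty, f is the Δ-characteristic vector of S(f,A), and f(k)=? only where A(k,k)≠0 as a symbol. *)

(* Defs.v *)
From HB Require Import structures.
From mathcomp Require Import all_boot all_order all_algebra.
From mathcomp Require Import complex.
From mathcomp Require Import boolp classical_sets reals.

Set Implicit Arguments.
Unset Strict Implicit.
Unset Printing Implicit Defensive.

Import Order.TTheory GRing.Theory Num.Theory.
Local Open Scope ring_scope.
Local Open Scope complex_scope.
Local Open Scope classical_set_scope.

(* Quest is the symbol ? (arbitrary entry). *)
Variant symbol := Zero | Star | Quest.

Definition is_star (s : symbol) : bool := if s is Star then true else false.
Definition is_quest (s : symbol) : bool := if s is Quest then true else false.

Definition conforms (R : realType) (s : symbol) (x : R) : Prop :=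
  match s with Zero => x = 0 | Star => x <> 0 | Quest => True end.

Definition pattern_class (R : realType) (n : nat) (P : 'M[symbol]_n) :
  set 'M[R]_n := [set A | forall i j, conforms (P i j) (A i j)].

Definition spectrum (R : realType) (n : nat) (A : 'M[R]_n) : set R[i] :=
  [set z | eigenvalue (map_mx (real_complex R) A) z].

(* Subsystem k has the 1 x 1 system matrix A k k, with spectrum {A k k}.
   The symbol 0 may be used only if Delta has at most one element. *)
Definition charvec (R : realType) (n : nat) (Delta : set R[i])
    (f : 'I_n -> symbol) : Prop :=
  (exists z1 z2, [/\ Delta z1, Delta z2 & z1 <> z2]) ->
  forall k, f k <> Zero.

(* f is the vector obtained from the set S of system matrices; [Quest] is the
   remaining case, [symbol] having only three elements. *)
Definition charvec_of (R : realType) (n : nat) (Delta : set R[i])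
    (S : set 'M[R]_n) (f : 'I_n -> symbol) : Prop :=
  forall k,
    (f k = Star <-> forall A, S A -> ~ Delta (A k k)%:C) /\
    (f k = Zero <-> exists mu, Delta = [set mu] /\
                      forall A, S A -> (A k k)%:C = mu).

Definition specified_class (R : realType) (n : nat) (Delta : set R[i])
    (f : 'I_n -> symbol) (P : 'M[symbol]_n) : set 'M[R]_n :=
  [set A | pattern_class P A /\
    forall k, (f k = Star -> ~ Delta (A k k)%:C) /\
              (f k = Zero -> forall mu, Delta = [set mu] -> (A k k)%:C = mu)].

(* The information carried by f is consistent with the pattern matrix:
   - some system matrix satisfies all the constraints;
   - f is the characteristic vector of the class of matrices it specifies, so
     that [Quest] is used only when neither [Star] nor [Zero] is warranted;
   - [Quest] is not used for a diagonal entry that P fixes to 0.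
   The second item implies the third, except when 0 belongs to Delta and Delta
   has another element: then A k k = 0 is known, but neither [Star] nor [Zero]
   can express it.
   None of this is needed for zero forcing to imply controllability.  The
   converse fails without the third item: take n = 3, Delta the whole plane, f
   constantly [Quest], and P with Star at (2,1), (1,3), (2,3) and Zero elsewhere
   (indices from 1).  All pairs (A, e_3) are controllable, but {3} forces no
   node. *)
Definition consistent (R : realType) (n : nat) (Delta : set R[i])
    (f : 'I_n -> symbol) (P : 'M[symbol]_n) : Prop :=
  [/\ specified_class Delta f P !=set0,
      charvec_of Delta (specified_class Delta f P) f
    & forall k, f k = Quest -> P k k <> Zero].

Definition input_matrix (R : realType) (n : nat) (VC : {set 'I_n}) :
  'M[R]_(n, #|VC|) := \matrix_(i, j) (i == enum_val j)%:R.

Definition controllable_pair (R : realType) (n m : nat)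
    (A : 'M[R]_n) (B : 'M[R]_(n, m)) : Prop :=
  \rank (\mxrow_(i < n) (A ^+ i *m B)) = n.

(* Au is the uncontrollable block of a Kalman decomposition of (A, B); T is the
   change of coordinates, with inverse U (so that r + s = n). *)
Definition kalman_uncontrollable_block (R : realType) (n m r s : nat)
    (A : 'M[R]_n) (B : 'M[R]_(n, m)) (Au : 'M[R]_s) : Prop :=
  exists (T : 'M[R]_(r + s, n)) (U : 'M[R]_(n, r + s))
         (Ac : 'M[R]_r) (Acu : 'M[R]_(r, s)) (Bc : 'M[R]_(r, m)),
    [/\ T *m U = 1%:M /\ U *m T = 1%:M,
        T *m A *m U = block_mx Ac Acu 0 Au,
        T *m B = col_mx Bc 0
      & controllable_pair Ac Bc].

(* Au is unique up to similarity, so the decomposition chosen is immaterial. *)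
Definition controllable_eigenvalue (R : realType) (n m : nat)
    (A : 'M[R]_n) (B : 'M[R]_(n, m)) (z : R[i]) : Prop :=
  spectrum A z /\
  exists (r s : nat) (Au : 'M[R]_s),
    kalman_uncontrollable_block r A B Au /\ ~ spectrum Au z.

Definition modal_ssc (R : realType) (n : nat) (Delta : set R[i])
    (f : 'I_n -> symbol) (P : 'M[symbol]_n) (VC : {set 'I_n}) : Prop :=
  forall z, Delta z -> forall A, specified_class Delta f P A ->
    spectrum A z -> controllable_eigenvalue A (input_matrix R VC) z.

(* [net_label f P v u] labels the edge from v to u: note
   the transposition, (v, u) being governed by P u v.  The diagonal of P is
   superseded by f. *)
Definition net_label (n : nat) (f : 'I_n -> symbol) (P : 'M[symbol]_n)
    (v u : 'I_n) : symbol := if v == u then f v else P u v.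

Definition strong_edge (n : nat) (f : 'I_n -> symbol) (P : 'M[symbol]_n) :
  rel 'I_n := fun v u => is_star (net_label f P v u).

Definition weak_edge (n : nat) (f : 'I_n -> symbol) (P : 'M[symbol]_n) :
  rel 'I_n := fun v u => is_quest (net_label f P v u).

(* es: strong edges, ew: weak edges *)
Definition white_outnbrs (V : finType) (es ew : rel V) (Z : {set V}) (v : V) :
  {set V} := [set u | (es v u || ew v u) && (u \notin Z)]%SET.

(* One application of the coloring rule, Z being the set of black nodes. *)
Definition color_step (V : finType) (es ew : rel V) : rel {set V} :=
  fun Z Z' => [exists v, exists u,
    [&& white_outnbrs es ew Z v == [set u]%SET, es v u & Z' == (u |: Z)%SET]].

Definition derived_set (V : finType) (es ew : rel V) (Z D : {set V}) : Prop :=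
  connect (color_step es ew) Z D /\ forall D', ~~ color_step es ew D D'.

Definition zero_forcing (V : finType) (es ew : rel V) (Z : {set V}) : Prop :=
  derived_set es ew Z [set: V]%SET.

(* Main.v *)
(* By the PBH test, an eigenvalue z of A is controllable iff no nonzero left
   eigenvector w for z vanishes on VC.  If w vanishes on the black nodes and u
   is the only white out-neighbor of v, along a strong edge, then the v-th
   column of w (A - z) = 0 reduces to w_u (A - z)_{uv} = 0, so w_u = 0: forcing
   propagates the vanishing of w.  Conversely, if the process stalls at a
   proper subset D, a real x in Delta and an admissible A can be found,
   column by column, for which the indicator of the complement of D is a left
   eigenvector for x: the white entries of each column of A - x can be made to
   sum to 0, as no column has a nonzero entry forced to stand alone. *)
Require Import Defs.
From HB Require Import structures.
From mathcomp Require Import all_boot all_order all_algebra.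
From mathcomp Require Import complex.
From mathcomp Require Import boolp classical_sets reals.

Set Implicit Arguments.
Unset Strict Implicit.
Unset Printing Implicit Defensive.

Import Order.TTheory GRing.Theory Num.Theory.
Local Open Scope ring_scope.
Local Open Scope complex_scope.
Local Open Scope classical_set_scope.

(** * Controllability matrices, the Kalman decomposition and the PBH test *)

Definition krylov (F : fieldType) (n m : nat) (A : 'M[F]_n) (B : 'M[F]_(n, m)) :=
  \mxrow_(i < n) (A ^+ i *m B).

(** By Cayley-Hamilton, every power of [A] is a polynomial in [A] of degree less than [n]. *)
Lemma krylov_annihilatorP (F : fieldType) (n m p : nat) (A : 'M[F]_n)
    (B : 'M[F]_(n, m)) (y : 'M[F]_(p, n)) :
  y *m krylov A B = 0 <-> forall k, y *m (A ^+ k *m B) = 0.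
Proof.
rewrite /krylov mul_mxrow; split=> [yK0 k|yAB0]; last first.
  by under eq_mxrow => i do rewrite yAB0; rewrite mxrow0.
case: n => [|n] in A B y yK0 *; first by rewrite [y]thinmx0 mul0mx.
have {}yK0 (i : 'I_n.+1) : y *m (A ^+ i *m B) = 0.
  by move: i; apply/eq_mxrowP; rewrite yK0 mxrow0.
pose q := 'X^k %% char_poly A.
have -> : A ^+ k = horner_mx A q.
  rewrite -[in LHS](horner_mx_X A) -rmorphXn /=.
  by rewrite [in LHS](divp_eq 'X^k (char_poly A)) rmorphD rmorphM /= Cayley_Hamilton
    mulr0 add0r.
have szq : (size q <= n.+1)%N.
  by rewrite -ltnS -(size_char_poly A) ltn_modp monic_neq0 ?char_poly_monic.
rewrite -[q]coefK poly_def rmorph_sum /= mulmx_suml mulmx_sumr big1 // => i _.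
rewrite linearZ /= rmorphXn /= horner_mx_X -scalemxAl -scalemxAr.
by rewrite (yK0 (widen_ord szq i)) scaler0.
Qed.

(** Carries the full rank of a real controllability matrix over to the complex field, where the left
    eigenvectors live. *)
Lemma map_krylov (F F' : fieldType) (g : {rmorphism F -> F'}) (n m : nat)
    (A : 'M[F]_n) (B : 'M[F]_(n, m)) :
  map_mx g (krylov A B) = krylov (map_mx g A) (map_mx g B).
Proof.
have mapX k : map_mx g (A ^+ k) = map_mx g A ^+ k.
  by elim: k => [|k IH]; rewrite ?expr0 ?map_mx1 // !exprS map_mxM IH.
apply/matrixP => i j; rewrite mxE [LHS](congr1 g (mxE _ _ _ _)) [RHS]mxE.
by rewrite -mapX -map_mxM [RHS]mxE.
Qed.

(** The zero block decouples the left half of [w *m U], which is subject to [Ac] and [Bc] alone;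
    once that half is 0, the right half satisfies the eigenvector equation of [Au]. *)
Lemma kalman_row_equations (F : fieldType) (n m r s : nat)
    (A : 'M[F]_n) (B : 'M[F]_(n, m)) (T : 'M[F]_(r + s, n))
    (U : 'M[F]_(n, r + s)) (Ac : 'M[F]_r) (Acu : 'M[F]_(r, s)) (Au : 'M[F]_s)
    (Bc : 'M[F]_(r, m)) (w : 'rV[F]_n) (z : F) :
  U *m T = 1%:M -> T *m A *m U = block_mx Ac Acu 0 Au ->
  T *m B = col_mx Bc 0 ->
  w *m A = z *: w -> w *m B = 0 ->
  [/\ lsubmx (w *m U) *m Ac = z *: lsubmx (w *m U),
      lsubmx (w *m U) *m Acu + rsubmx (w *m U) *m Au = z *: rsubmx (w *m U)
    & lsubmx (w *m U) *m Bc = 0].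
Proof.
move=> UT TAU TB wA wB.
have eA : (w *m U) *m block_mx Ac Acu 0 Au = z *: (w *m U).
  by rewrite -TAU !mulmxA -(mulmxA w U T) UT mulmx1 wA -scalemxAl.
have eB : (w *m U) *m col_mx Bc 0 = 0.
  by rewrite -TB !mulmxA -(mulmxA w U T) UT mulmx1 wB.
move: (w *m U) eA eB => v.
rewrite -{1 2}[v]hsubmxK mul_row_block scale_row_mx mulmx0 addr0.
case/eq_row_mx=> -> ->; rewrite -{1}[v]hsubmxK mul_row_col mulmx0 addr0.
by split.
Qed.

Lemma kalman_decomposition_exists (R : realType) (n m : nat) (A : 'M[R]_n)
    (B : 'M[R]_(n, m)) :
  exists (r s : nat) (T : 'M[R]_(r + s, n)) (U : 'M[R]_(n, r + s))
      (Ac : 'M[R]_r) (Acu : 'M[R]_(r, s)) (Au : 'M[R]_s) (Bc : 'M[R]_(r, m)),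
    [/\ T *m U = 1%:M /\ U *m T = 1%:M,
        T *m A *m U = block_mx Ac Acu 0 Au,
        T *m B = col_mx Bc 0
      & controllable_pair Ac Bc].
Proof.
(* The left kernel of the controllability matrix is A-invariant; its basis N
   gives the last rows of T, completed by a basis M of a complement. *)
pose K := kermx (krylov A B).
pose M := row_base (K^C)%MS; pose N := row_base K.
pose T := col_mx M N.
have T_full : row_full T.
  rewrite -sub1mx -addsmxE.
  have : row_full (K + K^C)%MS := addsmx_compl_full K.
  rewrite -sub1mx addsmxC => /submx_trans; apply.
  by apply: addsmxS; rewrite eq_row_base.
have T_free : row_free T.
  rewrite -row_leq_rank (eqnP T_full) mxrank_compl.
  by rewrite subnK // rank_leq_col.
have [U TU UT] : exists2 U, T *m U = 1%:M & U *m T = 1%:M.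
  by exists (pinvmx T); [exact: mulmxVp | exact: mulVpmx].
have KP p (y : 'M_(p, n)) :
    reflect (forall k, y *m (A ^+ k *m B) = 0) (y <= K)%MS.
  by apply: (iffP sub_kermxP) => /krylov_annihilatorP.
have NP : (N <= K)%MS by rewrite eq_row_base.
have NA : (N *m A <= N)%MS.
  rewrite eq_row_base; apply/KP => k.
  by have /KP/(_ k.+1) := NP; rewrite exprS -!mulmxA.
have NB : N *m B = 0.
  by have /KP/(_ 0%N) := NP; rewrite expr0 mul1mx.
have NU : N *m U = row_mx 0 1%:M.
  have : col_mx (M *m U) (N *m U) = block_mx 1%:M 0 0 1%:M.
    by rewrite -mul_col_mx TU -scalar_mx_block.
  by case/eq_col_mx.
have [X NAX] := submxP NA.
pose H := M *m A *m U.
have TAU : T *m A *m U = block_mx (lsubmx H) (rsubmx H) 0 X.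
  rewrite /T !mul_col_mx NAX -(mulmxA X) NU mul_mx_row mulmx0 mulmx1.
  by rewrite -[M *m A *m U]hsubmxK.
have TB : T *m B = col_mx (M *m B) 0 by rewrite mul_col_mx NB.
exists _, _, T, U, (lsubmx H), (rsubmx H), X, (M *m B); split=> //.
have powers k : T *m (A ^+ k *m B) = col_mx (lsubmx H ^+ k *m (M *m B)) 0.
  elim: k => [|k IH]; first by rewrite !expr0 !mul1mx.
  have -> : T *m (A ^+ k.+1 *m B) = (T *m A *m U) *m (T *m (A ^+ k *m B)).
    by rewrite !mulmxA -(mulmxA _ U T) UT mulmx1 exprS -!mulmxA.
  by rewrite IH TAU mul_block_col !mulmx0 mul0mx !addr0 exprS !mulmxA.
apply/eqP; apply: inj_row_free => y /krylov_annihilatorP y0.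
(* By [powers], a row [y] killing every [Ac ^+ k *m Bc] puts [y *m M] in the kernel [K]; but the
   rows of [M] span a complement of [K]. *)
have yM : (y *m M <= K :&: K^C)%MS.
  rewrite sub_capmx andbC (submx_trans (submxMl _ _)) ?eq_row_base //=.
  apply/KP => k; have := congr1 (mulmx (row_mx y 0)) (powers k).
  by rewrite mul_row_col mul0mx addr0 y0 mulmxA mul_row_col mul0mx addr0.
move: yM; rewrite capmx_compl submx0 => /eqP yM.
by apply: (row_free_inj (row_base_free (K^C)%MS)); rewrite -/M yM mul0mx.
Qed.

(* The Popov-Belevitch-Hautus test *)
Lemma controllable_eigenvalueP (R : realType) (n m : nat) (A : 'M[R]_n)
    (B : 'M[R]_(n, m)) (z : R[i]) : spectrum A z ->
  controllable_eigenvalue A B z <->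
  forall w : 'rV[R[i]]_n, w *m map_mx (real_complex R) A = z *: w ->
    w *m map_mx (real_complex R) B = 0 -> w = 0.
Proof.
move=> Az; split=> [[_ [r [s [Au [[T [U [Ac [Acu [Bc [TU TAU TB cc]]]]]]]]]]]|pbh].
  move=> Au_z w wA wB.
  have [_ UT] := TU.
  have := congr1 (map_mx (real_complex R)) UT.
  have := congr1 (map_mx (real_complex R)) TAU.
  have := congr1 (map_mx (real_complex R)) TB.
  rewrite map_block_mx map_col_mx !map_mxM map_mx1 !map_mx0 => TB' TAU' UT'.
  have [wAc wAu wBc] := kalman_row_equations UT' TAU' TB' wA wB.
  set w' := w *m _ in wAc wAu wBc.
  (* A row with eigenvalue [z] for [Ac] that kills [Bc] kills all [Ac ^+ k *m Bc], hence is 0 by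
     controllability of [(Ac, Bc)]. *)
  have w'l : lsubmx w' = 0.
    have free : row_free
        (krylov (map_mx (real_complex R) Ac) (map_mx (real_complex R) Bc)).
      by rewrite -map_krylov /row_free mxrank_map; apply/eqP.
    apply: (row_free_inj free); rewrite mul0mx; apply/krylov_annihilatorP => k.
    elim: k => [|k IH]; first by rewrite expr0 mul1mx.
    by rewrite exprS -mulmxA mulmxA wAc -scalemxAl IH scaler0.
  have w'r : rsubmx w' = 0.
    apply: contra_notP Au_z => /eqP w'r; apply/eigenvalueP.
    by exists (rsubmx w') => //; rewrite -wAu w'l mul0mx add0r.
  have : w' *m map_mx (real_complex R) T = w by rewrite -mulmxA UT' mulmx1.
  by rewrite -[w']hsubmxK w'l w'r row_mx0 mul0mx.
split=> //.
have [r [s [T [U [Ac [Acu [Au [Bc [[TU UT] TAU TB cc]]]]]]]]] :=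
  kalman_decomposition_exists A B.
exists r, s, Au; split; first by exists T, U, Ac, Acu, Bc.
move=> /eigenvalueP[y yA y_neq0].
have TA : T *m A = block_mx Ac Acu 0 Au *m T by rewrite -TAU -mulmxA UT mulmx1.
have {TA} := congr1 (map_mx (real_complex R)) TA.
have := congr1 (map_mx (real_complex R)) TB.
have := congr1 (map_mx (real_complex R)) TU.
rewrite !map_mxM map_block_mx map_col_mx map_mx1 !map_mx0 => TU' TB' TA'.
(* An eigenvector of [Au], padded by zeros and returned to the original coordinates, kills [B] since
   the lower block of [T *m B] is 0. *)
pose w := row_mx (0 : 'rV_r) y *m map_mx (real_complex R) T.
have w0 : w = 0.
  apply: pbh; last by rewrite -mulmxA TB' mul_row_col mulmx0 mul0mx addr0.
  rewrite -mulmxA TA' mulmxA mul_row_block !mul0mx mulmx0 !add0r yA.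
  by rewrite -[0 in LHS](scaler0 _ z) -scale_row_mx -scalemxAl.
have : row_mx (0 : 'rV_r) y = 0.
  by rewrite -[LHS]mulmx1 -TU' mulmxA -/w w0 mul0mx.
by move/eqP; rewrite row_mx_eq0 (negPf y_neq0) andbF.
Qed.

(** * The coloring process *)

Lemma color_stepP (V : finType) (es ew : rel V) (Z Z' : {set V}) :
  reflect (exists v u, [/\ white_outnbrs es ew Z v = [set u]%SET, es v u
                         & Z' = (u |: Z)%SET])
          (color_step es ew Z Z').
Proof.
apply: (iffP existsP) => [[v /existsP[u /and3P[/eqP ? ? /eqP ?]]]|[v [u [? ? ?]]]].
  by exists v, u.
by exists v; apply/existsP; exists u; apply/and3P; split=> //; apply/eqP.
Qed.

Lemma connect_color_step_subset (V : finType) (es ew : rel V) (Z D : {set V}) :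
  connect (color_step es ew) Z D -> Z \subset D.
Proof.
case/connectP=> p; elim: p Z => [|Z1 p IH] Z /=; first by move=> _ ->.
case/andP=> /color_stepP[v [u [_ _ ->]]] /IH sub /sub {}sub.
exact: fintype.subset_trans (finset.subsetUr _ _) sub.
Qed.

(** Each step adds a white node, so a reachable set of maximal cardinality is terminal. *)
Lemma derived_set_exists (V : finType) (es ew : rel V) (Z : {set V}) :
  exists D, derived_set es ew Z D.
Proof.
have [D ZD maxD] := arg_maxnP (fun D : {set V} => #|D|) (connect0 (color_step es ew) Z).
exists D; split=> // D'; apply/negP => DD'.
have := maxD _ (connect_trans ZD (connect1 DD')).
have /color_stepP[v [u [Nv _ ->]]] := DD'.
have : u \in white_outnbrs es ew D v by rewrite Nv set11.
by rewrite inE => /andP[_ uD]; rewrite cardsU1 uD add1n /= ltnn.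
Qed.

(** * Zero forcing implies controllability *)

Lemma mulmx_input_matrix_eq0 (R : realType) (n : nat) (VC : {set 'I_n})
    (w : 'rV[R[i]]_n) :
  w *m map_mx (real_complex R) (input_matrix R VC) = 0 <->
  forall k, k \in VC -> w 0 k = 0.
Proof.
have wBE j : (w *m map_mx (real_complex R) (input_matrix R VC)) 0 j = w 0 (enum_val j).
  rewrite mxE (bigD1 (enum_val j)) //= !mxE eqxx rmorph1 mulr1 big1 ?addr0 // => i.
  by rewrite !mxE => /negPf ->; rewrite rmorph0 mulr0.
split=> [wB k kVC|w0]; last first.
  by apply/rowP => j; rewrite wBE mxE w0 ?enum_valP.
by rewrite -(enum_rankK_in kVC kVC) -wBE wB mxE.
Qed.

Lemma zero_forcing_modal_ssc (R : realType) (n : nat) (Delta : set R[i])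
    (P : 'M[symbol]_n) (f : 'I_n -> symbol) (VC : {set 'I_n}) :
  charvec Delta f -> zero_forcing (strong_edge f P) (weak_edge f P) VC ->
  modal_ssc Delta f P VC.
Proof.
move=> Df [/connectP[p ppath plast] _] z Dz A [PA fA] Az.
apply/controllable_eigenvalueP => // w wA /mulmx_input_matrix_eq0.
have col v : \sum_i w 0 i * (A i v)%:C = z * w 0 v.
  have := congr1 (fun M : 'rV_n => M 0 v) wA; rewrite !mxE => <-.
  by apply: eq_bigr => i _; rewrite mxE.
suff wT (Z : {set 'I_n}) : path (color_step (strong_edge f P) (weak_edge f P)) Z p ->
    [set: 'I_n]%SET = last Z p -> (forall k, k \in Z -> w 0 k = 0) -> w = 0.
  exact: wT.
elim: p Z {ppath plast} => [|Z' p IH] Z /=.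
  by move=> _ <- w0; apply/rowP => k; rewrite mxE w0 ?inE.
case/andP=> /color_stepP[v [u [Nv vu ->]]] /IH {}IH /IH {}IH w0; apply: IH.
move=> k /finset.setU1P[->|/w0 //].
have label_u : net_label f P v u = Star.
  by move: vu; rewrite /strong_edge; case: net_label.
have := col v; rewrite (bigD1 u) //=.
have Zero_label i : i != u -> i \notin Z -> net_label f P v i = Zero.
  move=> iu iZ; have : i \notin white_outnbrs (strong_edge f P) (weak_edge f P) Z v.
    by rewrite Nv inE.
  by rewrite inE iZ andbT /strong_edge /weak_edge; case: net_label.
(* Only rows [u] and [v] can contribute to column [v]: [w] vanishes on black nodes, and other white
   nodes are not out-neighbors of [v]. *)
have off i : i != u -> i != v -> w 0 i * (A i v)%:C = 0.
  move=> iu iv; have [/w0 ->|iZ] := boolP (i \in Z); first by rewrite mul0r.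
  have := PA i v; have := Zero_label _ iu iZ.
  by rewrite /net_label eq_sym (negPf iv) => -> /= ->; rewrite mulr0.
have [uv|uv] := eqVneq u v.
  rewrite big1 => [|i iu]; last by rewrite off // -uv.
  move: label_u; rewrite uv addr0 mulrC /net_label eqxx => fv /eqP.
  rewrite -subr_eq0 -mulrBl mulf_eq0 subr_eq0 => /orP[/eqP Avv|/eqP //].
  by have [/(_ fv)] := fA v; rewrite Avv.
rewrite (bigD1 v) 1?eq_sym //= big1 => [|i /andP[iu iv]]; last exact: off.
have Auv : (A u v)%:C != 0.
  move: label_u; rewrite /net_label eq_sym (negPf uv) => Puv.
  by have := PA u v; rewrite Puv /= => /eqP; rewrite fmorph_eq0.
(* If [v] is white, it has no self-loop, so [f v] is [Zero]; [charvec] then reduces [Delta] to the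
   point [z], and [A v v] equals [z]. *)
have -> : w 0 v * (A v v)%:C = z * w 0 v.
  have [/w0 ->|vZ] := boolP (v \in Z); first by rewrite mul0r mulr0.
  have fv : f v = Zero.
    by have := Zero_label v; rewrite eq_sym uv vZ /net_label eqxx => ->.
  have [_ /(_ fv z) ->] := fA v; first by rewrite mulrC.
  apply/seteqP; split=> y /= => [Dy|-> //].
  by apply: contrapT => yz; apply: (Df _ v fv); exists y, z.
rewrite addr0 => /eqP; rewrite -subr_eq0 addrK mulf_eq0 (negPf Auv) orbF.
by move/eqP.
Qed.

(** * Controllability implies zero forcing *)

Lemma nonzero_summands (R : realFieldType) (I : finType) (S : {set I}) (t : R) :
  (0 < #|S|)%N -> t != 0 \/ (1 < #|S|)%N ->
  exists g : I -> R, (forall i, i \in S -> g i != 0) /\ \sum_(i in S) g i = t.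
Proof.
case/card_gt0P=> s sS large.
(* All summands but the one at [s] equal [c]. As [c] exceeds the absolute value of [t], the one at
   [s] is negative if [m] is positive; otherwise it is [t], nonzero by [large]. *)
pose c := `|t| + 1; pose m := #|S :\ s|%SET.
have c_gt0 : 0 < c by rewrite ltr_wpDl.
exists (fun i => if i == s then t - c *+ m else c); split=> [i _|].
  case: ifP => _; last exact: lt0r_neq0.
  have [m0|m_gt0] := posnP m.
    rewrite m0 subr0; case: large => //.
    by rewrite (cardsD1 s) sS -/m m0.
  rewrite subr_eq0 lt_eqF // (le_lt_trans (ler_norm t)) //.
  by rewrite (@lt_le_trans _ _ c) ?ltrDl // -mulr_natr ler_peMr ?ler1n // ltW.
rewrite (bigD1 s) //= eqxx.
rewrite (eq_bigl [in (S :\ s)%SET]) => [|i]; last by rewrite !inE andbC.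
rewrite (eq_bigr (fun=> c)) => [|i]; last by rewrite !inE => /andP[/negPf ->].
by rewrite sumr_const subrK.
Qed.

(** The specified class constrains each entry separately, so its matrices can be assembled from
    independently chosen columns. *)
Definition admissible_column (R : realType) (n : nat) (Delta : set R[i])
    (P : 'M[symbol]_n) (f : 'I_n -> symbol) (v : 'I_n) (c : 'I_n -> R) : Prop :=
  [/\ forall i, conforms (P i v) (c i),
      f v = Star -> ~ Delta (c v)%:C
    & f v = Zero -> forall mu, Delta = [set mu] -> (c v)%:C = mu].

(** The sum condition is coordinate [v] of the left eigenvector equation, at [x], for the indicator
    of the complement of [D]. *)
Lemma column_with_white_sum (R : realType) (n : nat) (Delta : set R[i])
    (P : 'M[symbol]_n) (f : 'I_n -> symbol) (D : {set 'I_n}) (A0 : 'M[R]_n)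
    (x : R) (v : 'I_n) :
  let es := strong_edge f P in let ew := weak_edge f P in
  specified_class Delta f P A0 -> charvec Delta f -> Delta x%:C ->
  (f v = Quest -> conforms (P v v) x) -> (f v = Quest -> P v v <> Zero) ->
  (forall u, white_outnbrs es ew D v = [set u]%SET -> ~~ es v u) ->
  exists2 c, admissible_column Delta P f v c &
    \sum_(i | i \notin D) c i = x *+ (v \notin D).
Proof.
move=> es ew [PA fA] Df Dx xP Pv stall.
pose N := white_outnbrs es ew D v; pose S := (N :\ v)%SET.
have esE i : i != v -> es v i = is_star (P i v).
  by rewrite /es /strong_edge /net_label eq_sym => /negPf ->.
have SE i : (i \in S) =
    [&& i != v, is_star (P i v) || is_quest (P i v) & i \notin D].
  rewrite in_setD1 inE; have [//|/= iv] := eqVneq i v.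
  by rewrite /es /ew /strong_edge /weak_edge /net_label eq_sym (negPf iv).
(* It remains to choose the diagonal entry d and the entries g of the other
   white out-neighbors of v. *)
suff [d [g [[dP dS dZ] gP gsum]]] : exists d g,
    [/\ [/\ conforms (P v v) d, f v = Star -> ~ Delta d%:C
          & f v = Zero -> forall mu, Delta = [set mu] -> d%:C = mu],
        forall i, i \in S -> conforms (P i v) (g i)
      & \sum_(i in S) g i = (x - d) *+ (v \notin D)].
  (* Off the diagonal, black entries are copied from [A0]; a white entry outside [S] has symbol
     [Zero]. *)
  exists (fun i => if i == v then d else if i \in S then g i
                   else if i \in D then A0 i v else 0).
    split=> [i||]; rewrite ?eqxx //; case: eqP => [->//|/eqP iv].
    case: ifPn => [/gP //|]; rewrite SE iv /=.
    by case: ifPn => [_ _|_]; [exact: PA | case: (P i v)].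
  have gS : \sum_(i | (i \notin D) && (i != v)) (if i == v then d else
      if i \in S then g i else if i \in D then A0 i v else 0) =
      (x - d) *+ (v \notin D).
    rewrite -gsum [RHS]big_mkcond [LHS]big_mkcond; apply: eq_bigr => i _.
    rewrite SE; have [->|iv] := eqVneq i v; rewrite /= ?andbF ?andbT //.
    by case: ifPn => iD; rewrite ?(negPf iD) ?andbF ?andbT.
  have [vD|vD] := boolP (v \in D).
    rewrite (eq_bigl (fun i => (i \notin D) && (i != v))) => [|i].
      by rewrite gS vD.
    by have [->|] := eqVneq i v; rewrite ?vD ?andbT.
  by rewrite (bigD1 v) //= gS eqxx vD addrC subrK.
(* Nonzero entries reach the target [t] except when [t] is 0 and [S] has at most one element; all
   entries are then 0, which is allowed because [stall] makes a sole edge weak. *)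
have choose_g t : t != 0 /\ (0 < #|S|)%N \/ t = 0 /\ N = S ->
    exists g : 'I_n -> R,
      (forall i, i \in S -> conforms (P i v) (g i)) /\ \sum_(i in S) g i = t.
  move=> H; have [large|] := boolP ((0 < #|S|)%N && ((t != 0) || (1 < #|S|)%N)).
    have /andP[S_gt0 /orP tS] := large.
    have [g [gn0 gsum]] := nonzero_summands S_gt0 tS; exists g; split=> // i iS.
    have /eqP gi := gn0 i iS; move: iS; rewrite SE => /and3P[_].
    by case: (P i v).
  rewrite negb_and -leqNgt leqn0 negb_or negbK -leqNgt => small.
  have [t0 NS] : t = 0 /\ N = S.
    by case: H small => // -[/negPf -> S_gt0]; rewrite eqn0Ngt S_gt0.
  exists (fun=> 0); split=> [i iS|]; last by rewrite big1.
  have S1 : #|S| = 1%N.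
    apply/eqP; rewrite eqn_leq; apply/andP; split; last by apply/card_gt0P; exists i.
    by case/orP: small => [/eqP ->|/andP[]].
  have NE : N = [set i]%SET.
    by rewrite NS; case/cards1P: (introT eqP S1) iS => j -> /set1P ->.
  have := stall i NE; move: iS; rewrite SE => /and3P[/esE ->].
  by case: (P i v).
have vN : (v \in N) = (v \notin D) && (is_star (f v) || is_quest (f v)).
  by rewrite inE /es /ew /strong_edge /weak_edge /net_label eqxx andbC.
have NS : v \notin N -> N = S.
  move=> /negPf vNN; apply/finset.setP => i; rewrite in_setD1.
  by have [->|] := eqVneq i v.
have [vD|vD] := boolP (v \in D).
  have [|g [gP gsum]] := choose_g 0; first by right; rewrite NS // vN vD.
  exists (A0 v v), g; rewrite gsum mulr0n; split=> //; split=> //.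
  - by case: (fA v).
  - by case: (fA v).
rewrite vD /= in vN.
case fv : (f v) vN => vN.
(* [f v] is [Zero]: [charvec] makes [x] the only point of [Delta], so the other white entries must
   sum to 0. *)
- have Ax : A0 v v = x.
    have [_ /(_ fv x%:C)] := fA v => A0x; apply: complexI; apply: A0x.
    apply/seteqP; split=> y /= => [Dy|-> //].
    by apply: contrapT => yx; apply: (Df _ v fv); exists y, x%:C.
  have [|g [gP gsum]] := choose_g 0; first by right; rewrite NS // vN.
  exists (A0 v v), g; rewrite gsum -Ax subrr; split=> //; split=> //.
  by case: (fA v) => _ /(_ fv).
(* [f v] is [Star]: the target is nonzero since [x] is in [Delta], and [S] is nonempty, as otherwise
   [v] would force itself. *)
- have nD : ~ Delta (A0 v v)%:C by case: (fA v) => /(_ fv).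
  have [|g [gP gsum]] := choose_g (x - A0 v v); last first.
    by exists (A0 v v), g.
  left; split; first by rewrite subr_eq0; apply/eqP => xA; rewrite -xA in nD.
  rewrite lt0n cards_eq0; apply/eqP => S0.
  have /stall : N = [set v]%SET.
    by rewrite -(finset.setD1K (_ : v \in N)) // -/S S0 finset.setU0.
  by rewrite /es /strong_edge /net_label eqxx fv.
- have [S0|S_gt0] := posnP #|S|.
    exists x, (fun=> 0); split; first by split=> //; exact: xP.
      by move=> i; rewrite (cards0_eq S0) inE.
    by rewrite subrr big1.
  (* A positive diagonal entry that differs from [x]: it conforms even to [Star] and leaves a
     nonzero target. *)
  pose d := `|x| + 1.
  have d_gt0 : 0 < d by rewrite ltr_wpDl.
  have [|g [gP gsum]] := choose_g (x - d).
    left; split=> //; rewrite subr_eq0 lt_eqF //.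
    by rewrite (le_lt_trans (ler_norm x)) ?ltrDl.
  exists d, g; split=> //; split=> //.
  by case: (P v v) (Pv fv) => //= _; apply/eqP/lt0r_neq0.
Qed.

(* Only x = 0 can clash with the pattern; if it is the only real point of Delta,
   consistency excludes a diagonal Star below a Quest. *)
Lemma consistent_real_point (R : realType) (n : nat) (Delta : set R[i])
    (P : 'M[symbol]_n) (f : 'I_n -> symbol) :
  (exists x : R, Delta x%:C) -> consistent Delta f P ->
  exists2 x : R, Delta x%:C & forall v, f v = Quest -> conforms (P v v) x.
Proof.
move=> [x0 Dx0] [_ fP Pd].
have [[x [Dx xn0]]|only0] := pselect (exists x : R, Delta x%:C /\ x <> 0).
  by exists x => // v /Pd; case: (P v v).
exists x0 => // v fv; case Pv : (P v v) (Pd v fv) => // _ /= x0_eq0.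
have [fStar _] := fP v.
(* Here [P v v] is [Star], so [A v v] is a nonzero real and cannot lie in [Delta]; this would make
   [f v] equal to [Star]. *)
suff /fStar : forall A, specified_class Delta f P A -> ~ Delta (A v v)%:C by rewrite fv.
move=> A [PA _] DA; apply: only0; exists (A v v); split=> //.
by have := PA v v; rewrite Pv.
Qed.

Lemma modal_ssc_zero_forcing (R : realType) (n : nat) (Delta : set R[i])
    (P : 'M[symbol]_n) (f : 'I_n -> symbol) (VC : {set 'I_n}) :
  (exists x : R, Delta x%:C) -> charvec Delta f -> consistent Delta f P ->
  modal_ssc Delta f P VC -> zero_forcing (strong_edge f P) (weak_edge f P) VC.
Proof.
move=> Dreal Df cons ssc.
have [x Dx xP] := consistent_real_point Dreal cons.
have [[A0 SA0] _ Pd] := cons.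
have [D [VCD stall]] := derived_set_exists (strong_edge f P) (weak_edge f P) VC.
suff DT : D = [set: 'I_n]%SET by rewrite /zero_forcing -DT; split.
have columns v : exists c : 'I_n -> R, admissible_column Delta P f v c /\
    \sum_(i | i \notin D) c i = x *+ (v \notin D).
  have stall_v u : white_outnbrs (strong_edge f P) (weak_edge f P) D v = [set u]%SET ->
      ~~ strong_edge f P v u.
    move=> Nu; apply/negP => vu; have /negP := stall (u |: D)%SET; apply.
    by apply/color_stepP; exists v, u.
  have [c] := column_with_white_sum SA0 Df Dx (xP v) (Pd v) stall_v.
  by exists c.
have [c {}columns] := choice columns.
pose A := \matrix_(i, j) c j i.
have SA : specified_class Delta f P A.
  split=> [i j|k]; rewrite mxE; last by have [[]] := columns k.
  by have [[]] := columns j.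
pose w := \row_i ((i \notin D)%:R : R).
have wA : w *m A = x *: w.
  apply/rowP => v; rewrite !mxE mulr_natr; have [_ <-] := columns v.
  rewrite [RHS]big_mkcond; apply: eq_bigr => i _; rewrite !mxE.
  by case: (i \notin D); rewrite ?mul1r ?mul0r.
pose wC := map_mx (real_complex R) w.
have wCA : wC *m map_mx (real_complex R) A = x%:C *: wC.
  by rewrite -map_mxM wA map_mxZ.
suff wC0 : wC = 0.
  apply/finset.setP => i; rewrite inE; apply/negPn/negP => iD.
  have := congr1 (fun M : 'rV_n => M 0 i) wC0; rewrite !mxE iD rmorph1.
  by move/eqP; rewrite oner_eq0.
(* If nonzero, [wC] puts [x] in the spectrum, so [ssc] applies; [wC] vanishes on [VC], a subset of
   [D], and the PBH test makes it 0. *)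
have [->//|wCn0] := eqVneq wC 0.
have Ax : spectrum A x%:C by apply/eigenvalueP; exists wC.
have /controllable_eigenvalueP pbh := ssc _ Dx _ SA Ax; apply: pbh => //.
apply/mulmx_input_matrix_eq0 => k kVC.
by rewrite !mxE (fintype.subsetP (connect_color_step_subset VCD) _ kVC) rmorph0.
Qed.

Theorem theorem2 (R : realType) (n : nat) (Delta : set R[i])
    (P : 'M[symbol]_n) (f : 'I_n -> symbol) (VC : {set 'I_n}) :
  (exists x : R, Delta x%:C) ->
  charvec Delta f ->
  (zero_forcing (strong_edge f P) (weak_edge f P) VC ->
     modal_ssc Delta f P VC) /\
  (consistent Delta f P ->
     (modal_ssc Delta f P VC <->
        zero_forcing (strong_edge f P) (weak_edge f P) VC)).
Proof.
move=> Dreal Df; split=> [|cons]; first exact: zero_forcing_modal_ssc.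
by split; [exact: modal_ssc_zero_forcing | exact: zero_forcing_modal_ssc].
Qed.
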